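(* Let $n,d\ge 1$ be integers and let $F_i:\mathbb{R}^d\to\mathbb{R}$, $i\in[n]$, be differentiable with gradients $\mathbf{f}_i=\nabla F_i$. Put $F=\sum_{i=1}^n F_i$, $\mathbf{f}=\frac1n\sum_{i=1}^n\mathbf{f}_i=\frac1n\nabla F$ and $B=\{\mathbf{z}\in\mathbb{R}^d:\mathbf{f}(\mathbf{z})=\mathbf{0}\}$. Assume: (1) there is a finite constant $K\ge 0$ with $\|\mathbf{f}_i(\mathbf{z})\|\le K$ for all $\mathbf{z}\in\mathbb{R}^d$ and $i\in[n]$; (2) each $\mathbf{f}_i$, $i\in[n]$, is Lipschitz continuous on $\mathbb{R}^d$; (3) $F$ is coercive, i.e. $F(\mathbf{z})\to\infty$ as $\|\mathbf{z}\|\to\infty$; (4) $\min_{\mathbf{z}\in\mathbb{R}^d}F(\mathbf{z})$ is attained, and $B$ is a union of finitely many connected components. Let $\{a(t)\}_{t\ge0}$ be a positive non-increasing sequence with $\sum_{t=0}^\infty a(t)=\infty$ and $\sum_{t=0}^\infty a^2(t)<\infty$, and let $\{G(t)\}_{t\ge 0}$ be an $S$-strongly connected sequence of directed graphs on $[n]$. Let $\mathbf{x}_i(t),\mathbf{z}_i(t)$ be generated, from any initial states $\mathbf{x}_i(0)\in\mathbb{R}^d$, by the deterministic push-sum optimization algorithm with step sizes $a(t)$ over $\{G(t)\}$ (defined in the context), and let $\bar{\mathbf{x}}(t)=\frac1n\sum_{i=1}^n\mathbf{x}_i(t)$. Then $\bar{\mathbf{x}}(t)$ and $\mathbf{z}_i(t)$,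 $i\in[n]$, converge as $t\to\infty$ either to a point of $B$ or to the boundary of one of the connected components of $B$.
   Context: Notation: $[n]=\{1,\dots,n\}$; time indices $t$ are non-negative integers. Convergence of a sequence to a set means that its distance to the set tends to $0$. Graphs: $G(t)=([n],E(t))$ is a directed graph for every $t\ge0$. The sequence $\{G(t)\}$ is $S$-strongly connected ($S\ge1$ an integer) if for every $t\ge0$ the graph $([n],E(t)\cup E(t+1)\cup\dots\cup E(t+S-1))$ is strongly connected. $N_i^{in}(t)$ and $N_i^{out}(t)$ are the in- and out-neighborhoods of node $i$ in $G(t)$; each node is always considered an in- and out-neighbor of itself. $d_i(t)$ is the out-degree of $i$, $d_i(t)=|N_i^{out}(t)|$. Deterministic push-sum optimization algorithm: $y_i(0)=1$ for all $i\in[n]$, and for $t\ge0$ and $i\in[n]$, $$\mathbf{w}_i(t+1)=\sum_{j\in N_i^{in}(t)}\frac{\mathbf{x}_j(t)}{d_j(t)},\quad y_i(t+1)=\sum_{j\in N_i^{in}(t)}\frac{y_j(t)}{d_j(t)},\quad \mathbf{z}_i(t+1)=\frac{\mathbf{w}_i(t+1)}{y_i(t+1)},$$ $$\mathbf{x}_i(t+1)=\mathbf{w}_i(t+1)-a(t+1)\,\mathbf{f}_i(\mathbf{z}_i(t+1)).$$ *)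

(* Defs.v *)
From HB Require Import structures.
From mathcomp Require Import all_boot all_order all_algebra.
From mathcomp Require Import all_classical all_reals all_analysis.

Set Implicit Arguments.
Unset Strict Implicit.
Unset Printing Implicit Defensive.

Import Order.TTheory GRing.Theory Num.Theory.
Import numFieldNormedType.Exports.

Local Open Scope classical_set_scope.
Local Open Scope ring_scope.

Section Euclidean.
Context {R : realType} {d : nat}.
Implicit Types (u v z : 'rV[R]_d) (A : set 'rV[R]_d).

(* The library norm [`|u|] on row vectors is the sup norm. *)
Definition enorm u : R := Num.sqrt (\sum_(j < d) u ord0 j ^+ 2).

Definition gradient (F : 'rV[R]_d -> R) z : 'rV[R]_d :=
  \row_(j < d) 'D_(delta_mx ord0 j) F z.

(* Extended-real valued, so that the distance to [set0] is [+oo]. *)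
Definition dist_set A z : \bar R := ereal_inf [set (enorm (z - a))%:E | a in A].

Definition cvg_to_set (u : nat -> 'rV[R]_d) A : Prop :=
  dist_set A (u t) @[t --> \oo] --> 0%E.

Definition boundary A : set 'rV[R]_d := closure A `\` A°.

Definition lipschitz_map (f : 'rV[R]_d -> 'rV[R]_d) : Prop :=
  exists L : R, forall u v, enorm (f u - f v) <= L * enorm (u - v).

Definition coercive (F : 'rV[R]_d -> R) : Prop :=
  forall M : R, exists r : R, forall z, r <= enorm z -> M <= F z.

End Euclidean.

Section Graphs.
Context {n : nat}.
Implicit Types (e : rel 'I_n) (G : nat -> rel 'I_n) (t : nat) (i : 'I_n).

Definition strongly_connected e : Prop := forall i j, connect e i j.

Definition S_strongly_connected (S : nat) G : Prop :=
  forall t, strongly_connected [rel i j | [exists k : 'I_S, G (t + k)%N i j]].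

(* [G t i j] is the edge from [i] to [j]; every node is its own neighbor,
   whether or not the graph has a self-loop there. *)
Definition in_nbr G t i : {set 'I_n} := [set j | (j == i) || G t j i].
Definition out_nbr G t i : {set 'I_n} := [set j | (j == i) || G t i j].
Definition out_degree G t i : nat := #|out_nbr G t i|.

End Graphs.

(* The value [z 0], which the algorithm does not define, is unconstrained,
   and so is [w 0]. *)
Definition push_sum {R : realType} {n d : nat}
    (f : 'I_n -> 'rV[R]_d -> 'rV[R]_d) (a : nat -> R) (G : nat -> rel 'I_n)
    (x w z : nat -> 'I_n -> 'rV[R]_d) (y : nat -> 'I_n -> R) : Prop :=
  (forall i, y 0%N i = 1) /\
  forall (t : nat) (i : 'I_n),
    [/\ w t.+1 i = \sum_(j in in_nbr G t i) (out_degree G t j)%:R^-1 *: x t j,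
        y t.+1 i = \sum_(j in in_nbr G t i) y t j / (out_degree G t j)%:R,
        z t.+1 i = (y t.+1 i)^-1 *: w t.+1 i &
        x t.+1 i = w t.+1 i - a t.+1 *: f i (z t.+1 i)].

Definition average {R : realType} {n d : nat} (x : 'I_n -> 'rV[R]_d) : 'rV[R]_d :=
  n%:R^-1 *: \sum_(i < n) x i.

(* Main.v *)
Require Import Defs.
From HB Require Import structures.
From mathcomp Require Import all_boot all_order all_algebra.
From mathcomp Require Import all_classical all_reals all_analysis.
From mathcomp Require Import ring lra.

Set Implicit Arguments.
Unset Strict Implicit.
Unset Printing Implicit Defensive.

Import Order.TTheory GRing.Theory Num.Theory.
Import numFieldNormedType.Exports.

Local Open Scope classical_set_scope.
Local Open Scope ring_scope.

(** The ratios [u_i = x_i / y_i] evolve by averaging with row-stochastic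
    matrices, perturbed by [O(a(t))]. Strong connectivity over windows and the
    lower bound on the weights [y_i] make the spread of the [u_i] contract over
    [n * S] steps, so that it is square summable. Both the mean of the [x_i] and
    each [z_i] are averages of the [u_i]; hence the mean follows gradient descent
    on [F] with steps [a(t)] and summable errors. By coercivity it stays bounded,
    the gradient along it tends to 0, and since its steps tend to 0 it
    approaches a single component [C] of [B]. Its steps taken inside [C] are
    summable: if it eventually stays in the interior of [C] it converges, and
    otherwise its excursions into the interior get arbitrarily short and it
    approaches the boundary of [C]. *)

(** * Averaging over strongly connected graphs *)

(** Every node is its own neighbor, so the sets only grow. If a nonempty [I t] gains nothing over a
    window of length [S], it is closed under the edges of a strongly connected graph and hence full.
    Otherwise each window adds a node, so [n] windows suffice. *)
Lemma spreading_full (n S : nat) (G : nat -> rel 'I_n) (t0 : nat)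
    (I : nat -> {set 'I_n}) :
  S_strongly_connected S G -> I 0%N != finset.set0 ->
  (forall t i j, j \in I t -> (i == j) || G (t0 + t)%N j i -> i \in I t.+1) ->
  I (n * S)%N = [set: 'I_n]%SET.
Proof.
move=> hG I0 step.
have mono t k : I t \subset I (t + k)%N.
  elim: k => [|k IHk]; first by rewrite addn0.
  apply/fintype.subsetP => i ti; rewrite addnS; apply: (step _ i i) => //.
    exact: (fintype.subsetP IHk).
  by rewrite eqxx.
have grow t : I t != finset.set0 -> I (t + S)%N = I t -> I t = [set: 'I_n]%SET.
  move=> /set0Pn[j tj] eqI; apply/setP => i; rewrite finset.in_setT.
  have /connectP[p] := hG (t0 + t)%N j i.
  elim: p j tj => [|k p IHp] j tj /= => [_ ->//|/andP[/existsP[m jk] kp]].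
  apply: (IHp k) => //; rewrite -eqI.
  (* The edge from [j] to [k] is present at offset [m] of the window: [k] enters at time [t + m + 1]
     and then stays until [t + S]. *)
  have -> : (t + S = (t + m).+1 + (S - m.+1))%N.
    by rewrite addSnnS subnSK ?ltn_ord// -addnA subnKC // ltnW.
  apply: (fintype.subsetP (mono _ _)); apply: (step _ _ j).
    exact: (fintype.subsetP (mono t m)).
  by rewrite addnA jk orbT.
have card k : (I (k * S)%N == [set: 'I_n]%SET) || (k < #|I (k * S)%N|)%N.
  elim: k => [|k IHk]; first by rewrite card_gt0 I0 orbT.
  have sub : I (k * S)%N \subset I (k.+1 * S)%N by rewrite mulSnr.
  case/orP: IHk => [/eqP full|ltk].
    by rewrite -finset.subTset -full sub.
  have [eqI|neqI] := eqVneq (I (k.+1 * S)%N) (I (k * S)%N).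
    rewrite eqI grow ?eqxx//; first by rewrite -card_gt0 (leq_trans _ ltk).
    by rewrite -mulSnr.
  apply/orP; right; apply: leq_ltn_trans ltk _; apply: proper_card.
  by rewrite finset.properEneq eq_sym neqI.
case/orP: (card n) => [/eqP//|].
by rewrite ltnNge -[X in (_ <= X)%N]card_ord max_card.
Qed.

(** * Summability of non-negative series *)

Section Series.
Context {R : realType}.
Implicit Types (b c : nat -> R).

Lemma cvg_series_bounded b M :
  (forall t, 0 <= b t) -> (forall T, \sum_(0 <= t < T) b t <= M) ->
  cvgn (series b).
Proof.
move=> b0 bM; apply: nondecreasing_is_cvgn; first exact: nondecreasing_series.
by exists M => _ [T _ <-]; exact: bM.
Qed.

Lemma series_bounded b : (forall t, 0 <= b t) -> cvgn (series b) ->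
  exists2 M, 0 <= M & forall T, \sum_(0 <= t < T) b t <= M.
Proof.
move=> b0 cb; exists (limn (series b)) => [|T].
  by apply: limr_ge => //; apply: nearW => T; apply: sumr_ge0.
by apply: nondecreasing_cvgn_le => //; exact: nondecreasing_series.
Qed.

Lemma series_small_tail c e : cvgn (series c) -> 0 < e ->
  exists T, forall s t, (T <= s)%N -> \sum_(s <= k < t) c k < e.
Proof.
move=> /cauchy_cvgP/cauchy_seriesP cc e0.
have [[A B] [[T1 _ hA] [T2 _ hB]] AB] := cc _ e0.
exists (maxn T1 T2) => s t; rewrite geq_max => /andP[T1s T2s].
have [ts|st] := leqP t s; first by rewrite big_geq.
apply: le_lt_trans (ler_norm _) _; apply: (AB (s, t)); split => /=.
  exact: hA.
by apply: hB => /=; rewrite (leq_trans T2s)// ltnW.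
Qed.

(** Summing the recursion up to [T], the shift by [N] costs only the first [N] terms. The partial
    sums of [b] thus bound themselves with factor [q < 1]. *)
Lemma summable_of_contraction b c (N : nat) (q : R) :
  (forall t, 0 <= b t) -> (forall t, 0 <= c t) -> q < 1 ->
  (forall t, b (t + N)%N <= q * b t + c t) ->
  cvgn (series c) -> cvgn (series b).
Proof.
move=> b0 c0 q1 bN /(series_bounded c0)[M M0 cM].
apply: (@cvg_series_bounded _
  ((1 - q)^-1 * (\sum_(0 <= t < N) b t + M))) => // T.
rewrite ler_pdivlMl ?subr_gt0//.
have : \sum_(0 <= t < T) b t <= \sum_(0 <= t < T + N) b t.
  by apply: nondecreasing_series (leq_addr N T).
rewrite addnC (big_cat_nat (leq0n N) (leq_addr T N))/=.
rewrite -{2}[N]add0n big_addn addKn => le1.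
have : \sum_(0 <= t < T) b (t + N)%N <= \sum_(0 <= t < T) (q * b t + c t).
  by apply: ler_sum.
rewrite big_split -mulr_sumr /=; have := cM T; lra.
Qed.

End Series.

(** * Contraction of the spread under perturbed averaging *)

Section Consensus.
Context {R : realType} {n : nat}.
Implicit Types (v : 'I_n -> R) (G : nat -> rel 'I_n).

(** This is maximum minus minimum. The default [0] is harmless, since the diagonal pairs contribute
    [0]. *)
Definition spread v : R := \big[Num.max/0]_(p : 'I_n * 'I_n) (v p.1 - v p.2).

Lemma spread_ge0 v : 0 <= spread v.
Proof. exact: bigmax_ge_id. Qed.

Lemma le_spread v i j : v i - v j <= spread v.
Proof. exact: (le_bigmax _ (fun p : 'I_n * 'I_n => v p.1 - v p.2) (i, j)). Qed.

Lemma spread_le v c :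
  0 <= c -> (forall i j, v i - v j <= c) -> spread v <= c.
Proof. by move=> c0 vc; apply/bigmax_leP; split=> // -[i j] _; exact: vc. Qed.

Lemma weighted_mean_le (p v : 'I_n -> R) (M : R) :
  (forall i, 0 <= p i) -> \sum_i p i = 1 -> (forall i, v i <= M) ->
  \sum_i p i * v i <= M.
Proof.
move=> p0 p1 vM; rewrite -[leRHS]mul1r -p1 mulr_suml.
by apply: ler_sum => i _; apply: ler_wpM2l.
Qed.

Lemma weighted_means_dist (p p' v : 'I_n -> R) :
  (forall i, 0 <= p i) -> \sum_i p i = 1 ->
  (forall i, 0 <= p' i) -> \sum_i p' i = 1 ->
  `|\sum_i p i * v i - \sum_i p' i * v i| <= spread v.
Proof.
have half r r' : (forall i, 0 <= r i) -> \sum_i r i = 1 ->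
    (forall i, 0 <= r' i) -> \sum_i r' i = 1 ->
    \sum_i r i * v i <= \sum_i r' i * v i + spread v.
  move=> r0 r1 r'0 r'1; apply: weighted_mean_le => // i.
  rewrite -lerBlDr.
  have := @weighted_mean_le r' (fun j => - v j) (spread v - v i) r'0 r'1.
  under eq_bigr do rewrite mulrN.
  rewrite sumrN => H.
  suff /H : forall j, - v j <= spread v - v i by lra.
  by move=> j; have := le_spread v i j; lra.
move=> p0 p1 p'0 p'1; rewrite ler_distl lerBlDr.
by rewrite !half.
Qed.

(* The sets of nodes that already feel the small value [u t0 j] spread over
   the whole network within [n * S] steps. *)
Lemma perturbed_averaging_upper (S : nat) G (P : nat -> 'I_n -> 'I_n -> R)
    (u : nat -> 'I_n -> R) (e : nat -> R) (q M m : R) (t0 : nat) (j0 : 'I_n) :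
  S_strongly_connected S G -> 0 <= q ->
  (forall t i j, 0 <= P t i j) -> (forall t i, \sum_j P t i j = 1) ->
  (forall t i j, (i == j) || G t j i -> q <= P t i j) ->
  (forall t i, `|u t.+1 i - \sum_j P t i j * u t j| <= e t) ->
  (forall j, u t0 j <= M) -> u t0 j0 <= m -> m <= M ->
  forall i, u (t0 + n * S)%N i <=
    M - q ^+ (n * S) * (M - m) + \sum_(k < n * S) e (t0 + k)%N.
Proof.
move=> hG q0 P0 P1 Pq ue uM um mM.
pose E t := \sum_(k < t) e (t0 + k)%N.
have ES t : E t.+1 = E t + e (t0 + t)%N by rewrite /E big_ord_recr.
have uME t i : u (t0 + t)%N i <= M + E t.
  elim: t i => [|t IHt] i; first by rewrite addn0 /E big_ord0 addr0.
  rewrite addnS ES; have := weighted_mean_le (P0 (t0 + t)%N i) (P1 _ _) IHt.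
  by move: (ue (t0 + t)%N i); rewrite ler_norml => /andP[_]; lra.
(* Up to the accumulated error [E t], these nodes lie below [M] by a deficit that an out-neighbor
   inherits with a factor of at least [q]. *)
pose I t := [set i | u (t0 + t)%N i <= M - q ^+ t * (M - m) + E t]%SET.
have full : I (n * S)%N = [set: 'I_n]%SET.
  apply: (spreading_full hG (t0 := t0)).
    apply/set0Pn; exists j0; rewrite inE addn0 expr0 /E big_ord0; lra.
  move=> t i j; rewrite !inE => uj /Pq ij; rewrite addnS ES exprS.
  have := ue (t0 + t)%N i; rewrite ler_norml => /andP[_].
  have mean : \sum_k P (t0 + t)%N i k * u (t0 + t)%N k <=
      M + E t - P (t0 + t)%N i j * (q ^+ t * (M - m)).
    rewrite -[M + E t]mul1r -(P1 (t0 + t)%N i) mulr_suml.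
    rewrite (bigD1 j)//= [in leRHS](bigD1 j)//=.
    have rest : \sum_(k | k != j) P (t0 + t)%N i k * u (t0 + t)%N k <=
        \sum_(k | k != j) P (t0 + t)%N i k * (M + E t).
      by apply: ler_sum => k _; apply: ler_wpM2l.
    have := ler_wpM2l (P0 (t0 + t)%N i j) uj; lra.
  have : q * (q ^+ t * (M - m)) <= P (t0 + t)%N i j * (q ^+ t * (M - m)).
    by apply: ler_wpM2r => //; rewrite mulr_ge0 ?exprn_ge0// subr_ge0.
  by lra.
by move=> i; have := finset.in_setT i; rewrite -full inE.
Qed.

(** Only the maximum is shown to contract, pulled down by the minimal node; the minimum drops by no
    more than the accumulated error. That error enters once from each side, hence the factor 2. *)
Lemma spread_contraction (S : nat) G (P : nat -> 'I_n -> 'I_n -> R)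
    (u : nat -> 'I_n -> R) (e : nat -> R) (q : R) :
  S_strongly_connected S G -> 0 <= q <= 1 ->
  (forall t i j, 0 <= P t i j) -> (forall t i, \sum_j P t i j = 1) ->
  (forall t i j, (i == j) || G t j i -> q <= P t i j) ->
  (forall t, 0 <= e t) ->
  (forall t i, `|u t.+1 i - \sum_j P t i j * u t j| <= e t) ->
  forall t, spread (u (t + n * S)%N) <=
    (1 - q ^+ (n * S)) * spread (u t) + 2 * \sum_(k < n * S) e (t + k)%N.
Proof.
move=> hG /andP[q0 q1] P0 P1 Pq e0 ue t.
have qN1 : q ^+ (n * S) <= 1 by apply: exprn_ile1.
have qN0 : 0 <= q ^+ (n * S) by apply: exprn_ge0.
have E0 : 0 <= \sum_(k < n * S) e (t + k)%N by apply: sumr_ge0.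
have D0 := spread_ge0 (u t).
apply: spread_le => [|i j].
  by rewrite addr_ge0 ?mulr_ge0// subr_ge0.
case: (@arg_maxP _ R _ i xpredT (u t) isT) => iM _ hM.
case: (@arg_minP _ R _ i xpredT (u t) isT) => im _ hm.
have mM : u t im <= u t iM by apply: hM.
have up := perturbed_averaging_upper hG q0 P0 P1 Pq ue
  (fun k => hM k isT) (lexx (u t im)) mM i.
have ueN s k : `|- u s.+1 k - \sum_l P s k l * - u s l| <= e s.
  rewrite -normrN opprB opprK addrC; apply: le_trans (ue s k).
  by under eq_bigr do rewrite mulrN; rewrite sumrN.
have hmN k : - u t k <= - u t im by rewrite lerN2 hm.
(* With [m = M] the deficit vanishes, leaving the plain lower bound on [u]. *)
have low := @perturbed_averaging_upper S G P (fun s k => - u s k) e q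
  (- u t im) (- u t im) t im hG q0 P0 P1 Pq ueN hmN (lexx _) (lexx _) j.
have : (1 - q ^+ (n * S)) * (u t iM - u t im) <=
    (1 - q ^+ (n * S)) * spread (u t).
  by apply: ler_wpM2l; rewrite ?subr_ge0// le_spread.
by move: up low => /=; lra.
Qed.

Lemma spread_square_summable (S : nat) G (P : nat -> 'I_n -> 'I_n -> R)
    (u : nat -> 'I_n -> R) (e : nat -> R) (q : R) :
  S_strongly_connected S G -> 0 < q <= 1 ->
  (forall t i j, 0 <= P t i j) -> (forall t i, \sum_j P t i j = 1) ->
  (forall t i j, (i == j) || G t j i -> q <= P t i j) ->
  (forall t, 0 <= e t) -> (forall s t, (s <= t)%N -> e t <= e s) ->
  cvgn (series (fun t => e t ^+ 2)) ->
  (forall t i, `|u t.+1 i - \sum_j P t i j * u t j| <= e t) ->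
  cvgn (series (fun t => spread (u t) ^+ 2)).
Proof.
move=> hG /andP[q0 q1] P0 P1 Pq e0 emono e2 ue.
set N := (n * S)%N; set h := q ^+ N.
have h0 : 0 < h by exact: exprn_gt0.
have h1 : h <= 1 by apply: exprn_ile1; rewrite // ltW.
(* Chosen so that the error [2 * N * e t] over one window equals [h * (C * e t)]; the bound on the
   new spread is then a convex combination with weights [1 - h] and [h]. *)
pose C := 2 * N%:R / h.
apply: (@summable_of_contraction _ _ (fun t => h * C ^+ 2 * e t ^+ 2) N (1 - h)).
- by move=> t; exact: sqr_ge0.
- by move=> t; rewrite mulr_ge0 ?sqr_ge0// mulr_ge0 ?sqr_ge0// ltW.
- lra.
- move=> t; have D0 := spread_ge0 (u t).
  have contr : spread (u (t + N)%N) <= (1 - h) * spread (u t) + h * (C * e t).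
    have qq : 0 <= q <= 1 by rewrite q1 ltW.
    apply: le_trans (spread_contraction hG qq P0 P1 Pq e0 ue t) _.
    rewrite lerD2l; have -> : h * (C * e t) = 2 * (N%:R * e t).
      by rewrite /C; field; rewrite gt_eqF.
    rewrite ler_pM2l//; apply: le_trans (ler_sum _ _) _.
      by move=> k _; apply: emono (leq_addr k t).
    by rewrite sumr_const card_ord mulr_natl.
  apply: (@le_trans _ _ (((1 - h) * spread (u t) + h * (C * e t)) ^+ 2)).
    rewrite ler_sqr ?nnegrE ?spread_ge0//.
    exact: le_trans (spread_ge0 _) contr.
  (* This is the gap in the convexity inequality for the square. *)
  have : 0 <= h * (1 - h) * (spread (u t) - C * e t) ^+ 2.
    by rewrite mulr_ge0 ?sqr_ge0// mulr_ge0 ?subr_ge0// ltW.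
  nra.
- by apply: is_cvg_seriesZ.
Qed.

End Consensus.

(** * Smooth functions of row vectors *)

Section RowVectors.
Context {R : realType} {d : nat}.
Implicit Types (u v h x : 'rV[R]_d) (F : 'rV[R]_d -> R).

Definition dot u v : R := \sum_(j < d) u ord0 j * v ord0 j.

Lemma dotDl u v h : dot (u + v) h = dot u h + dot v h.
Proof. by rewrite /dot -big_split; apply: eq_bigr => j _; rewrite mxE mulrDl. Qed.

Lemma dotDr u v h : dot h (u + v) = dot h u + dot h v.
Proof. by rewrite /dot -big_split; apply: eq_bigr => j _; rewrite mxE mulrDr. Qed.

Lemma dotZl c u v : dot (c *: u) v = c * dot u v.
Proof. by rewrite /dot mulr_sumr; apply: eq_bigr => j _; rewrite mxE mulrA. Qed.

Lemma dotZr c u v : dot u (c *: v) = c * dot u v.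
Proof. by rewrite /dot mulr_sumr; apply: eq_bigr => j _; rewrite mxE mulrCA. Qed.

Lemma dot_suml (I : Type) (r : seq I) (g : I -> 'rV[R]_d) h :
  dot (\sum_(i <- r) g i) h = \sum_(i <- r) dot (g i) h.
Proof.
rewrite /dot exchange_big; apply: eq_bigr => j _.
by rewrite summxE mulr_suml.
Qed.

Lemma norm_coord_le u j : `|u ord0 j| <= `|u|.
Proof.
rewrite {2}/Num.norm/= mx_normrE.
exact: (le_bigmax 0 (fun i : 'I_1 * 'I_d => `|u i.1 i.2|) (ord0, j)).
Qed.

Lemma norm_le_coord u c : 0 <= c -> (forall j, `|u ord0 j| <= c) -> `|u| <= c.
Proof.
move=> c0 uc; rewrite {1}/Num.norm/= mx_normrE.
by apply/bigmax_leP; split=> // -[i j] _; rewrite (ord1 i).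
Qed.

Lemma norm_le_enorm u : `|u| <= enorm u.
Proof.
apply: norm_le_coord => [|j]; first exact: sqrtr_ge0.
rewrite -sqrtr_sqr ler_wsqrtr// (bigD1 j)//= lerDl.
by apply: sumr_ge0 => k _; exact: sqr_ge0.
Qed.

Lemma enorm_le_norm u : enorm u <= d%:R * `|u|.
Proof.
rewrite -[leRHS]ger0_norm ?mulr_ge0// -sqrtr_sqr ler_wsqrtr//.
have [d0|d_gt0] := posnP d.
  rewrite [leLHS]big1 ?sqr_ge0// => j; by move: (ltn_ord j); rewrite {2}d0.
apply: (@le_trans _ _ (d%:R * `|u| ^+ 2)).
  rewrite -[X in _ <= X%:R * _]card_ord mulr_natl -sumr_const.
  apply: ler_sum => j _; rewrite -real_normK ?num_real//.
  by rewrite ler_sqr ?nnegrE//; exact: norm_coord_le.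
rewrite exprMn ler_wpM2r ?sqr_ge0// expr2 ler_peMl//.
by rewrite ler1n.
Qed.

Lemma dot_le_norm u v : `|dot u v| <= d%:R * (`|u| * `|v|).
Proof.
apply: le_trans (ler_norm_sum _ _ _) _.
rewrite -[X in _ <= X%:R * _]card_ord mulr_natl -sumr_const.
apply: ler_sum => j _; rewrite normrM.
by apply: ler_pM => //; exact: norm_coord_le.
Qed.

Lemma norm_sqr_le_dot u : `|u| ^+ 2 <= dot u u.
Proof.
have uu0 : 0 <= dot u u by apply: sumr_ge0 => j _; rewrite -expr2 sqr_ge0.
rewrite -[leRHS]sqr_sqrtr// ler_sqr ?nnegrE ?sqrtr_ge0//.
exact: norm_le_enorm.
Qed.

Lemma derive_gradient F x h : differentiable F x -> 'D_h F x = dot (gradient F x) h.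
Proof.
move=> dF; rewrite deriveE// {1}(row_sum_delta h) linear_sum.
by apply: eq_bigr => j _; rewrite linearZ /= mxE deriveE// [in RHS]mulrC.
Qed.

(** The mean value theorem along the segment gives the gradient at an intermediate point, within
    [L * |h|] of the gradient at [x]. The factor [d] comes from bounding [dot] by sup norms. *)
Lemma smooth_upper_bound F (L : R) :
  (forall x, differentiable F x) ->
  (forall x v, `|gradient F x - gradient F v| <= L * `|x - v|) ->
  forall x h, F (x + h) <= F x + dot (gradient F x) h + d%:R * L * `|h| ^+ 2.
Proof.
move=> dF FL x h; pose g (s : R) := F (x + s *: h).
have dg (s : R) : is_derive s 1 g (dot (gradient F (x + s *: h)) h).
  have E : (fun t : R => t^-1 *: ((g \o shift s) (t *: 1) - g s)) =
      (fun t => t^-1 *: ((F \o shift (x + s *: h)) (t *: h) - F (x + s *: h))).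
    apply/funext => t; rewrite /g /= /shift /=.
    by congr (_ *: (F _ - _)); rewrite [t *: 1]mulr1 scalerDl addrCA.
  have D : derivable F (x + s *: h) h by apply: diff_derivable.
  split; first by rewrite /derivable E.
  by rewrite -derive_gradient// /derive E.
have gc : {within `[0, 1]%classic, continuous g}.
  by apply: derivable_within_continuous => s _; apply: ex_derive.
have [c /[!in_itv]/= /andP[c0 c1]] := MVT ltr01 (fun s _ => dg s) gc.
rewrite /g scale1r scale0r addr0 subr0 mulr1 => /eqP; rewrite subr_eq => /eqP ->.
rewrite addrC -addrA lerD2l.
have -> : dot (gradient F (x + c *: h)) h = dot (gradient F x) h +
    dot (gradient F (x + c *: h) - gradient F x) h by rewrite -dotDl [gradient F x + _]addrC subrK.
rewrite lerD2l; apply: le_trans (ler_norm _) _.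
apply: le_trans (dot_le_norm _ _) _; rewrite -mulrA ler_wpM2l// expr2 mulrA.
rewrite ler_wpM2r//; apply: le_trans (FL _ _) _.
(* The sign of [L] is not assumed; a nonzero [h] forces [L] to be non-negative. *)
have [h0|h0] := eqVneq `|h| 0.
  by rewrite addrAC subrr add0r normrZ h0 !mulr0.
have L0 : 0 <= L.
  have := FL h 0; rewrite subr0 => le0; have := le_trans (normr_ge0 _) le0.
  by rewrite pmulr_lge0// lt_def h0 normr_ge0.
rewrite ler_wpM2l// addrAC subrr add0r normrZ (gtr0_norm c0).
by rewrite ler_piMl// ltW.
Qed.

End RowVectors.

(** * Limit sets of sequences with vanishing steps *)

Section RealSequences.
Context {R : realType}.
Implicit Types (a g h c V : nat -> R).

(** Telescoping bounds [V T] plus the partial sum of [g] by [V 0] plus the partial sum of [c]. *)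
Lemma quasi_descent V g c :
  (forall t, 0 <= V t) -> (forall t, 0 <= g t) -> (forall t, 0 <= c t) ->
  (forall t, V t.+1 <= V t - g t + c t) -> cvgn (series c) ->
  (exists M, forall t, V t <= M) /\ cvgn (series g).
Proof.
move=> V0 g0 c0 step /(series_bounded c0)[M M0 cM].
have sumV T : V T + \sum_(0 <= t < T) g t <= V 0%N + \sum_(0 <= t < T) c t.
  elim: T => [|T IHT]; first by rewrite !big_geq.
  by rewrite !big_nat_recr//=; have := step T; lra.
have G0 T : 0 <= \sum_(0 <= t < T) g t by apply: sumr_ge0.
split; [exists (V 0%N + M) => T|apply: (@cvg_series_bounded _ _ (V 0%N + M)) => // T].
  by have := sumV T; have := cM T; have := G0 T; lra.
by have := sumV T; have := cM T; have := V0 T; lra.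
Qed.

(* While [h] stays above [e], its increments [C a] are at most the summable
   [C a h^2 / e^2]; since the series of [a] diverges, [h] is below [e]
   infinitely often. *)
Lemma vanishing_of_weighted_square_summable a h (C : R) :
  (forall t, 0 <= a t) -> (forall M, exists T, M <= \sum_(0 <= t < T) a t) ->
  (forall t, 0 <= h t) -> 0 <= C -> (forall t, h t.+1 <= h t + C * a t) ->
  a t @[t --> \oo] --> 0 -> cvgn (series (fun t => a t * h t ^+ 2)) ->
  h t @[t --> \oo] --> 0.
Proof.
move=> a0 ainf h0 C0 step acv sah.
have hlow (e : R) N : 0 < e -> exists2 t, (N <= t)%N & h t < e.
  move=> e0; apply: contrapT => no.
  have he t : (N <= t)%N -> e <= h t.
    by move=> Nt; rewrite leNgt; apply/negP => lt; apply: no; exists t.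
  have [M M0 sM] := series_bounded (fun t => mulr_ge0 (a0 t) (sqr_ge0 (h t))) sah.
  have [T] := ainf (M / e ^+ 2 + 1 + \sum_(0 <= t < N) a t).
  apply/negP; rewrite -ltNge.
  apply: (@le_lt_trans _ _ (\sum_(0 <= t < N + T) a t)).
    by apply: nondecreasing_series (leq_addl N T).
  rewrite (big_cat_nat (leq0n N) (leq_addr T N))/= addrC ltrD2r.
  apply: (@le_lt_trans _ _ (M / e ^+ 2)); last by rewrite ltrDl.
  rewrite ler_pdivlMr ?exprn_gt0// mulr_suml.
  apply: le_trans (sM (N + T)%N).
  rewrite [leRHS](big_cat_nat (leq0n N) (leq_addr T N))/= -[leLHS]add0r.
  apply: lerD; first by apply: sumr_ge0 => t _; rewrite mulr_ge0 ?sqr_ge0.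
  rewrite big_nat_cond [leRHS]big_nat_cond.
  apply: ler_sum => t /andP[/andP[Nt _] _]; apply: ler_wpM2l => //.
  by rewrite ler_sqr ?nnegrE ?he// ltW.
(* The three shares are the level [e], one upward step across it, and the tail of [c]. *)
apply/cvgr0Pnorm_le => e' e'0; pose e := e' / 3.
have e0 : 0 < e by rewrite /e divr_gt0.
pose c t := C / e ^+ 2 * (a t * h t ^+ 2).
have c0 t : 0 <= c t.
  by rewrite /c mulr_ge0 ?mulr_ge0 ?sqr_ge0// invr_ge0 sqr_ge0.
have cc : cvgn (series c) by apply: is_cvg_seriesZ.
have [T1 tail] := series_small_tail cc e0.
have Ca : C * a t @[t --> \oo] --> 0 by rewrite -(mulr0 C); apply: cvgM acv; exact: cvg_cst.
have [T2 _ small] : \forall t \near \oo, `|C * a t| <= e.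
  by move/cvgr0Pnorm_le: Ca; exact.
have [t0 T0 ht0] := hlow e (maxn T1 T2) e0.
move: T0; rewrite geq_max => /andP[T10 T20].
(* Below level [e], the next value is at most [2 * e]; above it, the increment [C * a] is at most
   [c]. *)
have claim k : h (t0 + k)%N <= 2 * e + \sum_(t0 <= r < t0 + k) c r.
  elim: k => [|k IHk]; first by rewrite addn0 big_geq//; lra.
  rewrite addnS big_nat_recr ?leq_addr//=.
  have [lth|leh] := ltP (h (t0 + k)%N) e.
    have s0 : 0 <= \sum_(t0 <= r < t0 + k) c r by apply: sumr_ge0.
    have := small (t0 + k)%N (leq_trans T20 (leq_addr _ _)).
    move=> /(le_trans (ler_norm _)); have := step (t0 + k)%N.
    by have := c0 (t0 + k)%N; lra.
  apply: le_trans (step _) _; rewrite addrA lerD//.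
  rewrite /c mulrAC -mulrA ler_wpM2l// ler_pdivlMr ?exprn_gt0// ler_wpM2l//.
  by rewrite ler_sqr ?nnegrE// ltW.
exists t0 => // t /= le0; rewrite ger0_norm// -(subnKC le0).
apply: le_trans (claim _) _; have := tail t0 (t0 + (t - t0))%N T10.
have : e' = 3 * e by rewrite /e; field.
lra.
Qed.

End RealSequences.

Section LimitSets.
Context {R : realType} {d : nat}.
Implicit Types (X : nat -> 'rV[R]_d) (B C : set 'rV[R]_d).

Definition frequently (P : nat -> Prop) := forall N, exists2 t, (N <= t)%N & P t.

Lemma not_frequently P : ~ frequently P -> \forall t \near \oo, ~ P t.
Proof.
move=> /existsNP[N no]; exists N => // t /= Nt Pt; apply: no; by exists t.
Qed.

(** A witness in the sup norm replaces the infimum of Euclidean distances; [approaches_cvg_to_set]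
    passes to the latter. *)
Definition approaches X C := forall e : R, 0 < e ->
  \forall t \near \oo, exists2 c, C c & `|X t - c| < e.

(** [P] selects a subsequence, which must cluster somewhere in [B]. Allowing every [P] lets the
    property be applied to the times of a recurring bad event. *)
Definition limit_points_in X B := forall P, frequently P ->
  exists2 p, B p & forall V, nbhs p V -> frequently (fun t => P t /\ V (X t)).

(** Compactness of the closed ball gives a cluster point along [P], and continuity makes [phi]
    vanish there. *)
Lemma limit_points_zero X (phi : 'rV[R]_d -> R) (M : R) :
  (forall t, `|X t| <= M) -> continuous phi -> phi (X t) @[t --> \oo] --> 0 ->
  limit_points_in X [set p | phi p = 0].
Proof.
move=> XM cphi phi0 P fP.
pose F := X @ within P \oo.
have PF : ProperFilter F.
  apply: fmap_proper_filter; apply: Build_ProperFilter_ex => Q [N _ NQ].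
  by have [t Nt Pt] := fP N; exists t; exact: NQ.
pose K := [set p : 'rV[R]_d | `|p| <= M].
have cK : compact K.
  apply: bounded_closed_compact.
    by exists M; split; rewrite ?num_real// => r Mr p /= pM; apply: le_trans (ltW Mr).
  rewrite /K (_ : [set _ | _] = [set p : 'rV[R]_d | `|p| \in `]-oo, M]]); last first.
    by apply/seteqP; split=> p /=; rewrite in_itv.
  apply: (@preimage_closed _ _ (fun p : 'rV[R]_d => `|p|) [set x | x \in `]-oo, M]]).
    by move=> p _; exact: norm_continuous.
  exact: interval_closed.
have FK : F K by exists 0%N => // t _ _; exact: XM.
have [p [_ clp]] := cK F PF FK.
have freq V : nbhs p V -> frequently (fun t => P t /\ V (X t)).
  move=> pV N.
  have FN : F [set X t | t in [set t | (N <= t)%N /\ P t]].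
    by exists N => // t /= Nt Pt; exists t.
  by have [_ [[t [Nt Pt] <-] Vt]] := clp _ _ FN pV; exists t.
exists p => //=; apply/eqP; rewrite -normr_eq0 eq_le normr_ge0 andbT.
apply/ler_addgt0Pr => e e0; rewrite add0r.
have e2 : 0 < e / 2 by rewrite divr_gt0.
have [N _ small] : \forall t \near \oo, `|phi (X t)| <= e / 2.
  by move/cvgr0Pnorm_le: phi0; exact.
have near_p : nbhs p [set q | `|phi p - phi q| <= e / 2].
  by move: (cphi p) => /cvgrPdist_le; exact.
have [t Nt [_ /= pt]] := freq _ near_p N.
have := small t Nt; have := ler_normD (phi p - phi (X t)) (phi (X t)).
by rewrite subrK; lra.
Qed.

(** Finiteness makes the union [D] of the other components closed, so disjoint open sets [U] and [W]
    separate [C] from [D]. Eventually the sequence lies in the union of [U] and [W] and never steps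
    from [U] to [W]; as it visits [U] near [b], it stays there. *)
Lemma limit_component X B :
  closed B -> finite_set [set connected_component B b | b in B] ->
  limit_points_in X B -> X t.+1 - X t @[t --> \oo] --> (0 : 'rV[R]_d) ->
  exists2 b, B b & approaches X (connected_component B b).
Proof.
move=> clB finB limB step.
have [b Bb bfreq] := limB (fun=> True) (fun N => ex_intro2 _ _ N (leqnn N) I).
exists b => // e e0.
pose C := connected_component B b.
pose D := \bigcup_(E in [set connected_component B b' | b' in B] `\ C) E.
have clC : closed C by exact: component_closed.
have clD : closed D.
  apply: closed_bigcup => [|E [[b' _ <-] _]]; last exact: component_closed.
  by apply: sub_finite_set finB => E [].
have CD0 : C `&` D = set0.
  apply/seteqP; split=> // p [Cp [E [[b' _ <-] neE] b'p]]; apply: neE => /=.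
  by rewrite (same_connected_component b'p); exact/esym/same_connected_component.
have CD p : B p -> C p \/ D p.
  move=> Bp; have [Cp|nCp] := pselect (C p); [by left|right].
  exists (connected_component B p); last exact: connected_component_refl.
  split; first by exists p.
  by move=> /= E; apply: nCp; rewrite -E; exact: connected_component_refl.
have [U [W [oU oW CU DW UW0]]] :=
  (@normal_openP R _).1 (@pseudometric_normal R _) C D clC clD CD0.
(* A limit point [p] of the switching times lies in [C] or [D]. In [D], some [X t] lies in both [U]
   and [W]; in [C], the small step keeps some [X t.+1] in [U] as well as in [W]. *)
have noswitch : ~ frequently (fun t => U (X t) /\ W (X t.+1)).
  move=> /limB[p Bp fp].
  case: (CD _ Bp) => [Cp|Dp]; last first.
    have [t _ [[Ut _] Wt]] := fp _ (open_nbhs_nbhs (conj oW (DW _ Dp))) 0%N.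
    by have : (U `&` W) (X t) by []; rewrite UW0.
  have /nbhs_ballP[r /= r0 rU] := open_nbhs_nbhs (conj oU (CU _ Cp)).
  have r2 : 0 < r / 2 by rewrite divr_gt0.
  have [N _ small] : \forall t \near \oo, `|X t.+1 - X t| < r / 2.
    by move/cvgr0Pnorm_lt: step; exact.
  have [t Nt [[_ Wt] pt]] := fp _ (nbhsx_ballx p _ r2) N.
  have : (U `&` W) (X t.+1); last by rewrite UW0.
  split=> //; apply: rU; move: pt (small t Nt); rewrite -!ball_normE /=.
  have := ler_normD (p - X t) (X t - X t.+1); rewrite addrA subrK.
  by rewrite (distrC (X t)); lra.
(* Used with [V = U] to trap the sequence, then with the [e]-neighborhood of [C] to conclude. *)
have evUW (V : set 'rV[R]_d) : (forall p, C p -> nbhs p V) ->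
    \forall t \near \oo, V (X t) \/ W (X t).
  move=> CV; suff /not_frequently : ~ frequently (fun t => ~ (V (X t) \/ W (X t))).
    by apply: filterS => t; exact: contrapT.
  move=> /limB[p /CD[Cp|Dp] fp].
    by have [t _ [no Vt]] := fp _ (CV _ Cp) 0%N; apply: no; left.
  have [t _ [no Wt]] := fp _ (open_nbhs_nbhs (conj oW (DW _ Dp))) 0%N.
  by apply: no; right.
have nearU p : C p -> nbhs p U by move=> Cp; apply: open_nbhs_nbhs (conj oU (CU _ Cp)).
have [N1 _ hN1] := evUW U nearU.
have [N2 _ hN2] := not_frequently noswitch.
have [t0] := bfreq _ (nearU _ (connected_component_refl Bb)) (maxn N1 N2).
rewrite geq_max => /andP[N10 N20] [_ Ut0].
have inU k : U (X (t0 + k)%N).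
  elim: k => [|k Uk]; first by rewrite addn0.
  rewrite addnS; have [//|Wk] := hN1 (t0 + k).+1 (leq_trans N10 (leqW (leq_addr _ _))).
  by case: (hN2 (t0 + k)%N) => //; exact: leq_trans N20 (leq_addr _ _).
have nearC p : C p -> nbhs p [set q | exists2 c, C c & `|q - c| < e].
  move=> Cp; apply: filterS (nbhsx_ballx p e e0) => q.
  by rewrite -ball_normE /= distrC => pq; exists p.
have [N3 _ hN3] := evUW _ nearC.
exists (maxn t0 N3) => // t /=; rewrite geq_max => /andP[t0t N3t].
have [//|Wt] := hN3 t N3t.
have : (U `&` W) (X t) by split=> //; rewrite -(subnKC t0t).
by rewrite UW0.
Qed.

(** If [p] is outside [C], the last point of [C] on the segment from [c] to [p] is a boundary point
    no farther from [p] than [c]. If [p] is in [C], it is itself a boundary point. *)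
Lemma boundary_closer C p c :
  closed C -> ~ C° p -> C c -> exists2 b, boundary C b & `|p - b| <= `|p - c|.
Proof.
move=> clC nCp Cc.
have [Cp|nC] := pselect (C p).
  by exists p; [split => //; exact: subset_closure|rewrite subrr normr0].
pose gam (s : R) := c + s *: (p - c).
pose A := [set s : R | 0 <= s <= 1 /\ C (gam s)].
have A0 : A 0 by split; rewrite ?lexx ?ler01// /gam scale0r addr0.
have Aub : ubound A 1 by move=> s [/andP[]].
have supA : has_sup A by split; [exists 0|exists 1].
pose m := sup A.
have m0 : 0 <= m by exact: sup_upper_bound.
have m1 : m <= 1 by apply: sup_le_ub; first by exists 0.
have cgam : continuous gam.
  move=> s; apply: cvgD; first exact: cvg_cst.
  by apply: cvgZr_tmp; exact: cvg_id.
have Cm : C (gam m).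
  apply: clC => V /cgam /nbhs_ballP[e /= e0 eV].
  have [s As lts] := sup_adherent e0 supA.
  exists (gam s); split; first by case: As.
  apply: eV; rewrite /ball /= ger0_norm; first by rewrite ltrBlDr -ltrBlDl.
  by rewrite subr_ge0; exact: sup_upper_bound.
have mlt1 : m < 1.
  rewrite lt_neqAle m1 andbT; apply/eqP => mE; apply: nC.
  by move: Cm; rewrite mE /gam scale1r addrC subrK.
exists (gam m); last first.
  have -> : p - gam m = (1 - m) *: (p - c).
    by rewrite /gam scalerBl scale1r opprD addrA.
  rewrite normrZ ger0_norm ?subr_ge0// ler_piMl//; lra.
split; first exact: subset_closure.
move=> /cgam /nbhs_ballP[e /= e0 eC].
(* A parameter beyond the supremum [m], still in the unit interval and within [e] of [m]. *)
pose s := Num.min (m + e / 2) 1.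
have ms : m < s by rewrite lt_min mlt1 andbT ltrDl divr_gt0.
have : s <= m.
  apply: sup_upper_bound => //; split.
    by rewrite (le_trans m0 (ltW ms))/= ge_min lexx orbT.
  apply: eC; rewrite /ball /= distrC ger0_norm ?subr_ge0 ?(ltW ms)//.
  have : s <= m + e / 2 by rewrite ge_min lexx.
  lra.
by rewrite leNgt ms.
Qed.

(* If [X] keeps leaving the interior of [C], its excursions into the interior
   start close to the boundary and are short. *)
Lemma limit_point_or_boundary X B C (s : nat -> R) :
  closed C -> C `<=` B -> limit_points_in X B ->
  approaches X C ->
  X t.+1 - X t @[t --> \oo] --> (0 : 'rV[R]_d) ->
  (forall t, 0 <= s t) -> cvgn (series s) ->
  (forall t, B (X t) -> `|X t.+1 - X t| <= s t) ->
  (exists2 b, B b & approaches X [set b]) \/ approaches X (boundary C).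
Proof.
move=> clC CB limB nearC step s0 ss Xs.
have drift t k : (forall r, (t <= r < t + k)%N -> C° (X r)) ->
    `|X (t + k)%N - X t| <= \sum_(t <= r < t + k) s r.
  elim: k => [|k IHk] inC; first by rewrite addn0 subrr normr0 big_geq.
  rewrite addnS big_nat_recr ?leq_addr//=.
  have -> : X (t + k).+1 - X t = X (t + k)%N - X t + (X (t + k).+1 - X (t + k)%N).
    by rewrite [RHS]addrC addrA subrK.
  apply: le_trans (ler_normD _ _) _; apply: lerD.
    by apply: IHk => r /andP[tr rt]; apply: inC; rewrite tr addnS ltnS ltnW.
  have inCk : C° (X (t + k)%N) by apply: inC; rewrite leq_addr addnS ltnSn.
  by apply: Xs; apply: CB; exact: interior_subset.
(* If [X] eventually stays in the interior, the summable drift makes it converge to its limit point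
   [b]. *)
have [freq|] := pselect (frequently (fun t => ~ C° (X t))); last first.
  move=> /not_frequently[N _ inC]; left.
  have [b Bb fb] := limB (fun=> True) (fun N => ex_intro2 _ _ N (leqnn N) I).
  exists b => // e e0.
  have e2 : 0 < e / 2 by rewrite divr_gt0.
  have [T tail] := series_small_tail ss e2.
  exists (maxn N T) => // t /=; rewrite geq_max => /andP[Nt Tt].
  exists b => //; have [t' tt' [_ bt']] := fb _ (nbhsx_ballx b _ e2) t.
  have := drift t (t' - t)%N; rewrite (subnKC tt').
  have inCt r : (t <= r < t')%N -> C° (X r).
    by move=> /andP[tr _]; apply: contrapT; apply: inC; exact: leq_trans Nt tr.
  move=> /(_ inCt).
  have := tail t t' Tt; move: bt'; rewrite -ball_normE /=.
  have := ler_normD (b - X t') (X t' - X t); rewrite addrA subrK.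
  by rewrite (distrC (X t)); lra.
right=> e e0; have e3 : 0 < e / 3 by rewrite divr_gt0.
have [T1 _ hT1] := nearC _ e3.
have [T2 _ hT2] : \forall t \near \oo, `|X t.+1 - X t| < e / 3.
  by move/cvgr0Pnorm_lt: step; exact.
have [T3 hT3] := series_small_tail ss e3.
have [t0] := freq (maxn T1 (maxn T2 T3)).
rewrite !geq_max => /and3P[T10 T20 T30] out0.
(* The time [r] is the last one up to [t0 + k] outside the interior. The step leaving [X r] is small
   by [step]; the bound by [s] serves only from [r + 1] on. *)
have claim k : exists r, [/\ (t0 <= r <= t0 + k)%N, ~ C° (X r) &
    forall l, (r < l <= t0 + k)%N -> C° (X l)].
  elim: k => [|k [r [/andP[r0 rk] outr inr]]].
    exists t0; rewrite addn0 leqnn; split=> // l /andP[lt le].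
    by move: lt; rewrite ltnNge le.
  have [inC|outC] := pselect (C° (X (t0 + k).+1)); last first.
    exists (t0 + k).+1; rewrite addnS leqnn andbT; split=> //.
      by rewrite -addnS leq_addr.
    by move=> l /andP[lt le]; move: lt; rewrite ltnNge le.
  exists r; split; [by rewrite r0 addnS ltnW|exact: outr|].
  move=> l /andP[rl]; rewrite addnS leq_eqVlt => /predU1P[->//|lk].
  by apply: inr; rewrite rl.
exists t0 => // t /= t0t; have [r] := claim (t - t0)%N.
rewrite subnKC// => -[/andP[r0 rt] outr inr].
have [c Cc Xc] := hT1 r (leq_trans T10 r0).
have [b bb Xb] := boundary_closer clC outr Cc.
exists b => //; have {Xb} Xb := le_lt_trans Xb Xc.
move: rt; rewrite leq_eqVlt => /predU1P[<-|ltrt]; first by lra.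
have jump := hT2 r (leq_trans T20 r0).
have := drift r.+1 (t - r.+1)%N; rewrite (subnKC ltrt).
have inCl l : (r < l < t)%N -> C° (X l).
  by move=> /andP[rl lt]; apply: inr; rewrite rl ltnW.
move=> /(_ inCl).
have := hT3 r.+1 t (leq_trans T30 (leq_trans r0 (leqnSn r))).
have := ler_normD (X t - X r.+1) (X r.+1 - X r + (X r - b)).
have := ler_normD (X r.+1 - X r) (X r - b); move: jump => /=.
rewrite addrA subrK [X t - _ + _]addrA subrK; lra.
Qed.

Lemma approaches_tracking X (Z : nat -> 'rV[R]_d) C (r : nat -> R) :
  approaches X C -> (forall t, `|Z t.+1 - X t| <= r t) ->
  r t @[t --> \oo] --> 0 -> approaches Z C.
Proof.
move=> XC ZX r0 e e0; have e2 : 0 < e / 2 by rewrite divr_gt0.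
have [N1 _ h1] := XC _ e2.
have [N2 _ h2] : \forall t \near \oo, `|r t| < e / 2.
  by move/cvgr0Pnorm_lt: r0; exact.
(* The successor discards time [0], where [Z] is arbitrary. *)
exists (maxn N1 N2).+1 => // -[//|t]; rewrite /= ltnS geq_max => /andP[N1t N2t].
have [c Cc Xc] := h1 t N1t; exists c => //.
have := ler_normD (Z t.+1 - X t) (X t - c); rewrite addrA subrK.
by have := h2 t N2t; have := ler_norm (r t); have := ZX t; rewrite /=; lra.
Qed.

Lemma approaches_cvg X b : approaches X [set b] -> X t @[t --> \oo] --> b.
Proof.
move=> Xb; apply/cvgrPdist_lt => e /Xb; apply: filterS => t [_ -> lt].
by rewrite distrC.
Qed.

Lemma approaches_cvg_to_set X C : approaches X C -> cvg_to_set X C.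
Proof.
move=> XC.
have dist_ge0 v : (0 <= dist_set C v)%E.
  by apply/ereal_infP => _ [c _ <-]; rewrite lee_fin sqrtr_ge0.
have small (e : R) : 0 < e -> \forall t \near \oo, (dist_set C (X t) <= e%:E)%E.
  (* Adding 1 makes the divisor positive even for [d = 0]. *)
  move=> e0; have d1 : 0 < d%:R + 1 :> R by rewrite ltr_wpDl.
  have := XC _ (divr_gt0 e0 d1); apply: filterS => t [c Cc Xc].
  apply: le_trans (ereal_inf_lbound _) _; first by exists c.
  rewrite lee_fin; apply: le_trans (enorm_le_norm _) _.
  apply: (@le_trans _ _ ((d%:R + 1) * `|X t - c|)).
    by apply: ler_wpM2r => //; rewrite lerDl.
  by rewrite mulrC -ler_pdivlMr// ltW.
apply/fine_cvgP; split.
  apply: filterS (small 1 ltr01) => t le1; rewrite ge0_fin_numE//.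
  exact: le_lt_trans le1 (ltry _).
apply/cvgr0Pnorm_le => e e0; apply: filterS (small e e0) => t /= le.
rewrite ger0_norm ?fine_ge0// -lee_fin fineK// ge0_fin_numE//.
exact: le_lt_trans le (ltry _).
Qed.

End LimitSets.

(** * Push-sum *)

Lemma cvg0_of_square_summable {R : realType} (b : nat -> R) :
  cvgn (series (fun t => b t ^+ 2)) -> b t @[t --> \oo] --> 0.
Proof.
move=> /cvg_series_cvg_0/cvgr0Pnorm_lt b2; apply/cvgr0Pnorm_lt => e e0.
apply: filterS (b2 _ (exprn_gt0 2 e0)) => t.
by rewrite normrX ltr_pXn2r ?nnegrE// ltW.
Qed.

Lemma cvg_series_sum {R : realType} (I : finType) (b : I -> nat -> R) :
  (forall i t, 0 <= b i t) -> (forall i, cvgn (series (b i))) ->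
  cvgn (series (fun t => \sum_i b i t)).
Proof.
move=> b0 cb.
have /choice[M hM] : forall i, exists M, forall T, \sum_(0 <= t < T) b i t <= M.
  by move=> i; have [M _ hM] := series_bounded (b0 i) (cb i); exists M.
apply: (@cvg_series_bounded _ _ (\sum_i M i)) => [t|T]; first exact: sumr_ge0.
by rewrite exchange_big; apply: ler_sum.
Qed.

Section Average.
Context {R : realType} {n d : nat}.
Implicit Types (u v : 'I_n -> 'rV[R]_d).

Lemma averageB u v : average u - average v = average (fun i => u i - v i).
Proof. by rewrite /average -scalerBr sumrB. Qed.

Lemma average_coord u j :
  average u ord0 j = \sum_i n%:R^-1 * u i ord0 j.
Proof. by rewrite /average mxE summxE mulr_sumr. Qed.

Lemma norm_average_le u (c : R) :
  (0 < n)%N -> (forall i, `|u i| <= c) -> `|average u| <= c.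
Proof.
move=> n0 uc; have n0' : 0 < n%:R :> R by rewrite ltr0n.
rewrite normrZ ger0_norm ?invr_ge0// ler_pdivrMl//.
apply: le_trans (ler_norm_sum _ _ _) _.
rewrite -[X in _ <= X%:R * _]card_ord mulr_natl -sumr_const.
exact: ler_sum.
Qed.

End Average.

Section PushSum.
Context {R : realType} {n d : nat}.
Variables (f : 'I_n -> 'rV[R]_d -> 'rV[R]_d) (a : nat -> R) (S : nat).
Variables (G : nat -> rel 'I_n) (x w z : nat -> 'I_n -> 'rV[R]_d).
Variables (y : nat -> 'I_n -> R) (K : R).
Hypotheses (n_gt0 : (0 < n)%N) (hG : S_strongly_connected S G).
Hypothesis halg : push_sum f a G x w z y.
Hypothesis fK : forall i v, `|f i v| <= K.
Hypotheses (a_gt0 : forall t, 0 < a t)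
  (a_noninc : forall s t, (s <= t)%N -> a t <= a s)
  (a_sum2 : cvgn (series (fun t => a t ^+ 2))).

Let deg_gt0 t i : (0 < out_degree G t i)%N.
Proof. by apply/card_gt0P; exists i; rewrite inE eqxx. Qed.

Let deg_le t i : (out_degree G t i <= n)%N.
Proof. by rewrite -[X in (_ <= X)%N]card_ord max_card. Qed.

Let n_neq0 : n%:R != 0 :> R.
Proof. by rewrite pnatr_eq0 -lt0n. Qed.

(** Double counting of edges: node [j] is counted once for each of its out-neighbors. This yields
    conservation of the totals of [x] and [y] under mixing. *)
Let sum_in_nbr (V : nmodType) t (g : 'I_n -> V) :
  \sum_i \sum_(j in in_nbr G t i) g j = \sum_j g j *+ out_degree G t j.
Proof.
rewrite (exchange_big_dep xpredT)//=; apply: eq_bigr => j _.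
rewrite -sumr_const; apply: eq_bigl => i.
by rewrite !inE eq_sym.
Qed.

Let yE t i :
  y t.+1 i = \sum_(j in in_nbr G t i) y t j / (out_degree G t j)%:R.
Proof. by have [_ /(_ t i)[]] := halg. Qed.

Let wE t i :
  w t.+1 i = \sum_(j in in_nbr G t i) (out_degree G t j)%:R^-1 *: x t j.
Proof. by have [_ /(_ t i)[]] := halg. Qed.

Let zE t i : z t.+1 i = (y t.+1 i)^-1 *: w t.+1 i.
Proof. by have [_ /(_ t i)[]] := halg. Qed.

Let xE t i : x t.+1 i = w t.+1 i - a t.+1 *: f i (z t.+1 i).
Proof. by have [_ /(_ t i)[]] := halg. Qed.

Lemma average_step t :
  average (x t.+1) = average (x t) - a t.+1 *: average (fun i => f i (z t.+1 i)).
Proof.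
rewrite /average scalerA [a _ * _]mulrC -scalerA -scalerBr; congr (_ *: _).
under eq_bigr do rewrite xE.
rewrite sumrB scaler_sumr; congr (_ - _).
under eq_bigr do rewrite wE.
rewrite sum_in_nbr.
apply: eq_bigr => j _.
by rewrite scalerMnl -mulr_natr mulVf ?scale1r// pnatr_eq0 -lt0n.
Qed.

Let sum_y t : \sum_i y t i = n%:R.
Proof.
have [y0 _] := halg; elim: t => [|t IHt].
  by under eq_bigr do rewrite y0; rewrite sumr_const card_ord.
under eq_bigr do rewrite yE.
rewrite sum_in_nbr -IHt.
apply: eq_bigr => j _.
by rewrite -[LHS]mulr_natr mulfVK// pnatr_eq0 -lt0n.
Qed.

Let y_gt0 t i : 0 < y t i.
Proof.
have [y0 _] := halg; elim: t i => [|t IHt] i; first by rewrite y0.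
rewrite yE (bigD1 i) ?inE ?eqxx//=.
apply: ltr_pwDl; first by rewrite divr_gt0// ltr0n.
by apply: sumr_ge0 => j _; rewrite divr_ge0// ltW.
Qed.

Let y_le t i : y t i <= n%:R.
Proof.
rewrite -(sum_y t) (bigD1 i)//= lerDl.
by apply: sumr_ge0 => j _; exact: ltW.
Qed.

Let beta : R := n%:R^-1.

Let beta_gt0 : 0 < beta.
Proof. by rewrite invr_gt0 ltr0n. Qed.

Let beta_le1 : beta <= 1.
Proof. by rewrite invf_le1 ?ltr0n// ler1n. Qed.

Let beta_deg t j : beta <= (out_degree G t j)%:R^-1.
Proof. by rewrite lef_pV2 ?posrE ?ltr0n// ler_nat. Qed.

Let y_step t i j : j \in in_nbr G t i -> beta * y t j <= y t.+1 i.
Proof.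
move=> ij; rewrite yE (bigD1 j)//= mulrC; apply: ler_wpDr.
  by apply: sumr_ge0 => k _; rewrite divr_ge0// ltW.
by rewrite ler_wpM2l// ltW.
Qed.

(** Each step passes on at least a fraction [beta] of a weight. Before time [n * S], decay from [1]
    gives the bound. Later, some weight was at least [1] exactly [n * S] steps earlier, since the
    weights sum to [n], and its mass has reached every node. *)
Let y_lower t i : beta ^+ (n * S) <= y t i.
Proof.
have self s k : beta * y s k <= y s.+1 k by apply: y_step; rewrite inE eqxx.
have [lt|] := ltnP t (n * S).
  apply: (@le_trans _ _ (beta ^+ t)).
    by apply: ler_wiXn2l; [exact: ltW|exact: beta_le1|exact: ltnW].
  elim: t i {lt} => [|t IHt] i; first by have [-> _] := halg; rewrite expr0.
  by rewrite exprS; apply: le_trans (self _ _); rewrite ler_wpM2l// ltW.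
move=> /subnK <-; set s := (t - n * S)%N.
pose I k := [set i | beta ^+ k <= y (s + k)%N i]%SET.
have full : I (n * S)%N = [set: 'I_n]%SET.
  apply: (spreading_full hG (t0 := s)) => [|k i' j].
    apply/set0Pn; apply: contrapT => no.
    have ylt1 j : y s j < 1.
      rewrite ltNge; apply/negP => le1; apply: no; exists j.
      by rewrite inE addn0 expr0.
    have : \sum_j y s j < \sum_(j < n) 1.
      apply: ltr_sum => [|j _]; last exact: ylt1.
      by apply/hasP; exists (Ordinal n_gt0) => //; rewrite mem_index_enum.
    by rewrite sum_y sumr_const card_ord ltxx.
  rewrite !inE addnS => yj ij; rewrite exprS.
  apply: (@le_trans _ _ (beta * y (s + k)%N j)).
    by rewrite ler_wpM2l// ltW.
  by apply: y_step; rewrite inE eq_sym.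
by have := finset.in_setT i; rewrite -full inE.
Qed.

(* The ratios [x i / y i] evolve by row-stochastic averaging; their average
   with weights [y i / n] is the mean of the [x i], and [z] is another average
   of them. *)
Lemma push_sum_consensus : exists delta : nat -> R,
  [/\ forall t, 0 <= delta t, cvgn (series (fun t => delta t ^+ 2)) &
      forall t i, `|z t.+1 i - average (x t)| <= delta t].
Proof.
have y_neq0 t i : y t i != 0 by rewrite gt_eqF.
pose c : R := beta ^+ (n * S).
have c0 : 0 < c by exact: exprn_gt0.
have c1 : c <= 1 by apply: exprn_ile1; rewrite ?beta_le1// ltW.
have K0 : 0 <= K by exact: le_trans (normr_ge0 (f (Ordinal n_gt0) 0)) (fK _ _).
pose P t i j : R := if j \in in_nbr G t i
  then y t j / (out_degree G t j)%:R / y t.+1 i else 0.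
have P0 t i j : 0 <= P t i j.
  by rewrite /P; case: ifP => // _; rewrite !divr_ge0// ltW.
have P1 t i : \sum_j P t i j = 1.
  rewrite -big_mkcond/= -mulr_suml -yE.
  by rewrite mulfV.
(* The factors bound the inverse degree, [y t j], and the inverse of [y t.+1 i], which is at most
   [n]. *)
have Pq t i j : (i == j) || G t j i -> beta * c * beta <= P t i j.
  move=> ij; rewrite /P ifT; last by rewrite inE eq_sym.
  rewrite [beta * c]mulrC; apply: ler_pM.
  - by rewrite mulr_ge0// ltW.
  - exact: ltW.
  - by apply: ler_pM; [exact: ltW|exact: ltW|exact: y_lower|exact: beta_deg].
  - by rewrite lef_pV2 ?posrE ?ltr0n.
pose u (k : 'I_d) t i : R := x t i ord0 k / y t i.
have zu k t i : z t.+1 i ord0 k = \sum_j P t i j * u k t j.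
  rewrite zE wE mxE summxE mulr_sumr.
  rewrite big_mkcond; apply: eq_bigr => j _; rewrite /P /u.
  case: ifP => _; last by rewrite mul0r.
  by rewrite mxE; field; rewrite !y_neq0 pnatr_eq0 -lt0n deg_gt0.
have xu k t : average (x t) ord0 k = \sum_j (beta * y t j) * u k t j.
  rewrite average_coord; apply: eq_bigr => j _; rewrite /u /beta.
  by field; rewrite y_neq0 n_neq0.
(* The gradient step, of size at most [K * a t], is divided by a weight that is at least [c]. *)
pose e t := K / c * a t.
have sp2 k : cvgn (series (fun t => spread (u k t) ^+ 2)).
  apply: (spread_square_summable (e := e) (q := beta * c * beta) hG _ P0 P1 Pq).
  - rewrite !mulr_gt0//= mulr_ile1 ?mulr_ile1 ?mulr_ge0 ?beta_le1//; exact: ltW.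
  - by move=> t; rewrite /e mulr_ge0 ?divr_ge0// ltW.
  - by move=> s t st; rewrite /e ler_wpM2l ?a_noninc// divr_ge0// ltW.
  - rewrite /e; under eq_fun do rewrite exprMn.
    exact: is_cvg_seriesZ.
  - move=> t i; rewrite -zu /u;
    have -> : z t.+1 i ord0 k = w t.+1 i ord0 k / y t.+1 i.
      by rewrite zE mxE mulrC.
    rewrite xE !mxE mulrDl addrAC subrr add0r.
    rewrite mulNr normrN !normrM (gtr0_norm (a_gt0 _)) normfV (gtr0_norm (y_gt0 _ _)).
    rewrite /e -mulrA mulrC; apply: ler_pM.
    + by rewrite divr_ge0// ltW.
    + exact: ltW.
    + apply: ler_pM => //; first by rewrite invr_ge0 ltW.
        exact: le_trans (norm_coord_le _ _) (fK _ _).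
      by rewrite lef_pV2 ?posrE// y_lower.
    + exact: a_noninc.
pose D2 t := \sum_k spread (u k t) ^+ 2.
have D20 t : 0 <= D2 t by apply: sumr_ge0 => k _; exact: sqr_ge0.
(* This dominates the spread in every coordinate, and its square is a finite sum of summable
   sequences. *)
exists (fun t => Num.sqrt (D2 t)); split.
- by move=> t; exact: sqrtr_ge0.
- under eq_fun do rewrite sqr_sqrtr//.
  by apply: cvg_series_sum => // k t; exact: sqr_ge0.
- move=> t i; apply: norm_le_coord => [|k]; first exact: sqrtr_ge0.
  apply: (@le_trans _ _ (spread (u k t))).
    rewrite !mxE zu; have := xu k t; rewrite mxE => ->.
    apply: weighted_means_dist => // [j|].
      by rewrite mulr_ge0// ltW.
    by rewrite -mulr_sumr sum_y mulVf.
  rewrite -[leLHS]ger0_norm ?spread_ge0// -sqrtr_sqr ler_wsqrtr//.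
  rewrite /D2 (bigD1 k)//= lerDl.
  by apply: sumr_ge0 => l _; exact: sqr_ge0.
Qed.

End PushSum.

(** * Perturbed gradient descent of the mean *)

Theorem theorem3 (R : realType) (n d : nat) (hn : (1 <= n)%N) (hd : (1 <= d)%N)
    (F : 'I_n -> 'rV[R]_d -> R)
    (hF : forall i z, differentiable (F i) z)
    (hbounded : exists2 K : R, 0 <= K &
       forall i z, enorm (gradient (F i) z) <= K)
    (hlipschitz : forall i, lipschitz_map (gradient (F i)))
    (hcoercive : coercive (fun z => \sum_(i < n) F i z))
    (hmin : exists z0, forall z, \sum_(i < n) F i z0 <= \sum_(i < n) F i z)
    (B : set 'rV[R]_d)
    (hB : B = [set z | average (fun i => gradient (F i) z) = 0])
    (hcomponents : finite_set [set connected_component B b | b in B])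
    (a : nat -> R)
    (ha_pos : forall t, 0 < a t)
    (ha_noninc : forall s t, (s <= t)%N -> a t <= a s)
    (ha_sum : series a @ \oo --> +oo)
    (ha_sum2 : cvgn (series (fun t => a t ^+ 2)))
    (S : nat) (hS : (1 <= S)%N)
    (G : nat -> rel 'I_n) (hG : S_strongly_connected S G)
    (x w z : nat -> 'I_n -> 'rV[R]_d) (y : nat -> 'I_n -> R)
    (halg : push_sum (fun i => gradient (F i)) a G x w z y) :
  (exists2 b : 'rV[R]_d, B b &
     average (x t) @[t --> \oo] --> b /\
     forall i, z t i @[t --> \oo] --> b) \/
  (exists2 b : 'rV[R]_d, B b &
     cvg_to_set (fun t => average (x t)) (boundary (connected_component B b)) /\
     forall i, cvg_to_set (fun t => z t i) (boundary (connected_component B b))).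
Proof.
have [K0 K0_ge0 gradK0] := hbounded.
pose f i := gradient (F i).
have fK i v : `|f i v| <= K0 by exact: le_trans (norm_le_enorm _) (gradK0 i v).
have [L L0 fL] : exists2 L, 0 <= L & forall i u v, `|f i u - f i v| <= L * `|u - v|.
  have /choice[l hl] := hlipschitz.
  (* One constant for all [i]; the absolute values guard against negative Lipschitz constants, and
     [d] converts between the norms. *)
  exists (\sum_i `|l i| * d%:R) => [|i u v].
    by apply: sumr_ge0 => i _; rewrite mulr_ge0.
  apply: le_trans (norm_le_enorm _) _; apply: le_trans (hl i u v) _.
  apply: (@le_trans _ _ (`|l i| * enorm (u - v))).
    by rewrite ler_wpM2r ?sqrtr_ge0// ler_norm.
  apply: (@le_trans _ _ (`|l i| * d%:R * `|u - v|)).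
    by rewrite -mulrA ler_wpM2l// enorm_le_norm.
  rewrite ler_wpM2r// (bigD1 i)//= lerDl.
  by apply: sumr_ge0 => j _; rewrite mulr_ge0.
have [delta [delta0 delta2 zdelta]] :=
  push_sum_consensus hn hG halg fK ha_pos ha_noninc ha_sum2.
pose X t := average (x t).
pose fb v := average (fun i => f i v).
pose p t := average (fun i => f i (z t.+1 i)).
have XS t : X t.+1 = X t - a t.+1 *: p t by exact: average_step halg t.
have fbL u v : `|fb u - fb v| <= L * `|u - v|.
  by rewrite /fb averageB; apply: norm_average_le => // i; exact: fL.
have fbK v : `|fb v| <= K0 by apply: norm_average_le => // i; exact: fK.
have pK t : `|p t| <= K0 by apply: norm_average_le => // i; exact: fK.
have pfb t : `|p t - fb (X t)| <= L * delta t.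
  rewrite /p /fb averageB; apply: norm_average_le => // i.
  by apply: le_trans (fL _ _ _) _; rewrite ler_wpM2l.
have aS t : a t.+1 <= a t by exact: ha_noninc.
have n_ge1 : 1 <= n%:R :> R by rewrite ler1n.
have cad : cvgn (series (fun t => a t ^+ 2 + delta t ^+ 2)).
  exact: is_cvg_seriesD.
have aS_delta t : a t.+1 * delta t <= a t ^+ 2 + delta t ^+ 2.
  apply: le_trans (ler_wpM2r (delta0 t) (aS t)) _.
  by have := sqr_ge0 (a t - delta t); have := sqr_ge0 (a t);
     have := sqr_ge0 (delta t); lra.
have a_cvg0 : a t.+1 @[t --> \oo] --> 0.
  by rewrite (cvg_shiftS a); exact: cvg0_of_square_summable.
have Xstep t : `|X t.+1 - X t| <= K0 * a t.+1.
  rewrite XS addrAC subrr add0r normrN normrZ (gtr0_norm (ha_pos _)) mulrC.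
  by rewrite ler_wpM2r// ltW.
pose Fs v := \sum_i F i v.
(* The error has two sources: the gradients are evaluated at [z] instead of the mean, costing order
   [a * delta], and the second-order term costs order [a ^ 2]. The factor [n] of the descent term is
   dropped. *)
have descent t : Fs (X t.+1) <= Fs (X t) - a t.+1 * `|fb (X t)| ^+ 2 +
    (n%:R * d%:R * L * (K0 + K0 ^+ 2)) * (a t ^+ 2 + delta t ^+ 2).
  set h := - (a t.+1 *: p t).
  have up : Fs (X t.+1) <= Fs (X t) + n%:R * dot (fb (X t)) h +
      n%:R * (d%:R * L * `|h| ^+ 2).
    have -> : n%:R * dot (fb (X t)) h = \sum_i dot (f i (X t)) h.
      by rewrite -dotZl scalerA mulfV ?scale1r ?dot_suml// gt_eqF// (lt_le_trans ltr01).
    rewrite -[n in n%:R * (_ * _)]card_ord mulr_natl -sumr_const -!big_split XS.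
    by apply: ler_sum => i _; apply: smooth_upper_bound => // u v; exact: fL.
  have hle : `|h| ^+ 2 <= K0 ^+ 2 * (a t ^+ 2 + delta t ^+ 2).
    apply: (@le_trans _ _ ((K0 * a t) ^+ 2)).
      rewrite ler_sqr ?nnegrE ?mulr_ge0 ?(ltW (ha_pos _))//.
      rewrite normrN normrZ (gtr0_norm (ha_pos _)) mulrC.
      by apply: ler_pM => //; exact: ltW.
    by rewrite exprMn ler_wpM2l ?sqr_ge0// lerDl sqr_ge0.
  have doth : dot (fb (X t)) h <= - (a t.+1 * `|fb (X t)| ^+ 2) +
      d%:R * L * K0 * (a t ^+ 2 + delta t ^+ 2).
    have -> : h = (- a t.+1) *: (fb (X t) + (p t - fb (X t))).
      by rewrite addrC subrK scaleNr.
    rewrite dotZr dotDr mulrDr; apply: lerD.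
      by rewrite mulNr lerN2 ler_wpM2l ?norm_sqr_le_dot// ltW.
    apply: le_trans (ler_norm _) _.
    rewrite normrM normrN (gtr0_norm (ha_pos _)).
    apply: (@le_trans _ _ (a t.+1 * (d%:R * (K0 * (L * delta t))))).
      rewrite ler_wpM2l ?(ltW (ha_pos _))//; apply: le_trans (dot_le_norm _ _) _.
      by rewrite ler_wpM2l// ler_pM.
    have -> : a t.+1 * (d%:R * (K0 * (L * delta t))) =
      d%:R * L * K0 * (a t.+1 * delta t) by ring.
    by rewrite ler_wpM2l// !mulr_ge0.
  have g0 : 0 <= a t.+1 * `|fb (X t)| ^+ 2 by rewrite mulr_ge0 ?sqr_ge0// ltW.
  have le1 := ler_wpM2l (le_trans ler01 n_ge1) doth.
  have n0 : 0 <= n%:R :> R by exact: le_trans ler01 n_ge1.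
  have le2 : n%:R * (d%:R * L * `|h| ^+ 2) <=
      n%:R * (d%:R * L * (K0 ^+ 2 * (a t ^+ 2 + delta t ^+ 2))).
    by rewrite ler_wpM2l// ler_wpM2l// mulr_ge0.
  have le3 := ler_wpM2r g0 n_ge1; rewrite mul1r in le3.
  lra.
have [zmin hzmin] := hmin.
pose c t := (n%:R * d%:R * L * (K0 + K0 ^+ 2)) * (a t ^+ 2 + delta t ^+ 2).
have c0 t : 0 <= c t.
  by rewrite /c !mulr_ge0 ?addr_ge0 ?sqr_ge0.
have [[M VM] sumg] : (exists M, forall t, Fs (X t) - Fs zmin <= M) /\
    cvgn (series (fun t => a t.+1 * `|fb (X t)| ^+ 2)).
  apply: (quasi_descent (c := c)) => //.
  - by move=> t; rewrite subr_ge0; exact: hzmin.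
  - by move=> t; rewrite mulr_ge0 ?sqr_ge0// ltW.
  - by move=> t; have := descent t; rewrite /c; lra.
  - exact: is_cvg_seriesZ.
(* The added 1 puts this level strictly above all values of [Fs] along [X]. *)
have [r hr] := hcoercive (M + Fs zmin + 1).
have Xr t : `|X t| <= r.
  apply: le_trans (norm_le_enorm _) _; rewrite leNgt; apply/negP => /ltW/hr.
  by have := VM t; rewrite /Fs; lra.
pose phi v := `|fb v|.
have phi_cont : continuous phi.
  move=> u; apply/(@cvgrPdist_lt _ _ _ (nbhs u) _ phi (phi u)) => e e0.
  have L1 : 0 < L + 1 by rewrite ltr_wpDl.
  apply: filterS (nbhsx_ballx u _ (divr_gt0 e0 L1)) => v.
  rewrite -ball_normE /= ltr_pdivlMr// => uv.
  apply: le_lt_trans (ler_dist_dist _ _) _; apply: le_lt_trans (fbL _ _) _.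
  by apply: le_lt_trans uv; rewrite mulrC ler_wpM2l// lerDl.
have phi0 : phi (X t) @[t --> \oo] --> 0.
  apply: (@vanishing_of_weighted_square_summable _ (fun t => a t.+1) _ (L * K0)) => //.
  - by move=> t; exact: ltW.
  (* The shifted series omits [a 0], so the target is raised by that amount. *)
  - move=> B0; move/cvgryPge: ha_sum => /(_ (B0 + a 0%N))[N _ hN].
    exists N; have := hN N.+1 (leqnSn N).
    by rewrite /series /= big_nat_recl//= ; lra.
  - by move=> t; exact: normr_ge0.
  - exact: mulr_ge0.
  - move=> t; have := ler_normD (fb (X t.+1) - fb (X t)) (fb (X t)).
    have := le_trans (fbL (X t.+1) (X t)) (ler_wpM2l L0 (Xstep t)).
    by rewrite subrK /phi; lra.
have BE : B = [set v | phi v = 0].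
  rewrite hB; apply/seteqP; split=> v /= => [fv0|/eqP].
    by rewrite /phi /fb fv0 normr0.
  by rewrite normr_eq0 => /eqP.
have clB : closed B.
  rewrite BE; apply: (@preimage_closed _ _ phi [set 0]).
    by move=> v _; exact: phi_cont.
  exact: (accessible_closed_set1 (hausdorff_accessible (@norm_hausdorff _ _))).
have limB : limit_points_in X B.
  by rewrite BE; exact: limit_points_zero Xr phi_cont phi0.
have step0 : X t.+1 - X t @[t --> \oo] --> (0 : 'rV[R]_d).
  apply/cvgr0Pnorm_lt => e e0; have K1 : 0 < K0 + 1 by rewrite ltr_wpDl.
  move/cvgr0Pnorm_lt: a_cvg0 => /(_ _ (divr_gt0 e0 K1)); apply: filterS => t.
  rewrite (gtr0_norm (ha_pos _)) ltr_pdivlMr// => lt.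
  apply: le_lt_trans (Xstep t) _; apply: le_lt_trans lt.
  by rewrite mulrC ler_wpM2l ?lerDl// ltW.
have [b Bb XC] := limit_component clB hcomponents limB step0.
have delta_cvg0 := cvg0_of_square_summable delta2.
have zX A : approaches X A -> forall i, approaches (fun t => z t i) A.
  by move=> XA i; apply: approaches_tracking XA _ delta_cvg0 => t; exact: zdelta.
(* On [B] the gradient at the mean vanishes, so a step has norm at most [a t.+1 * (L * delta t)],
   which [s t] dominates. *)
pose s t := L * (a t ^+ 2 + delta t ^+ 2).
have s0 t : 0 <= s t by rewrite /s mulr_ge0 ?addr_ge0 ?sqr_ge0.
have cs : cvgn (series s) by exact: is_cvg_seriesZ.
have Bstep t : B (X t) -> `|X t.+1 - X t| <= s t.
  rewrite BE /= => /eqP; rewrite normr_eq0 => /eqP fb0.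
  rewrite XS addrAC subrr add0r normrN normrZ (gtr0_norm (ha_pos _)).
  have := pfb t; rewrite fb0 subr0 => /(ler_wpM2l (ltW (ha_pos t.+1))).
  by move=> /le_trans; apply; rewrite mulrCA ler_wpM2l.
have [[b' Bb' Xb']|XbC] := limit_point_or_boundary (component_closed clB)
  (@connected_component_sub _ _ _) limB XC step0 s0 cs Bstep.
- left; exists b' => //; split; first exact: approaches_cvg.
  by move=> i; apply: approaches_cvg; exact: zX.
- right; exists b => //; split; first exact: approaches_cvg_to_set.
  by move=> i; apply: approaches_cvg_to_set; exact: zX.
Qed.
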